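(* Let $r$ and $s$ be positive integers satisfying one of the following conditions: (a) $r\equiv2\pmod 3$ and $s\equiv2\pmod 6$; (b) $r\equiv s\equiv0\pmod 3$; (c) $r\equiv1\pmod 3$, $r\ge4$, and $s\equiv4\pmod 6$. Then for every non-negative integer $n=n_0+3n_1+9n_2+\dots+3^mn_m$ with $0\le n_i\le2$ for all $i$, $$a_n(r,s)\equiv\prod_{i=0}^{m}a_{n_i}(r,s)\pmod 9 .$$
   Context: For non-negative integers $r,s,n$, the (generalised) Apéry numbers are $a_n(r,s)=\sum_{k=0}^n\binom nk^r\binom{n+k}k^s$. *)

(* Defs.v *)
From mathcomp Require Import all_boot.
Set Implicit Arguments.
Unset Strict Implicit.
Unset Printing Implicit Defensive.

Definition apery (r s n : nat) : nat :=
  \sum_(k < n.+1) 'C(n, k) ^ r * 'C(n + k, k) ^ s.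

(* Main.v *)
(** By induction it is enough to show [a (3n + c) = a c * a n] modulo 9 for a
    digit [c].  Group the terms of [a (3n + c)] by the residue of the index
    [3k + k0].  Since [r, s >= 2], a term vanishes modulo 9 as soon as 3 divides
    one of its binomials, so only [k0 <= c] with [c + k0 <= 2] survives.  There
    each binomial is ['C(n, k)] (or ['C(n + k, k)]) times an explicit linear
    factor.  The congruence thus holds block by block in [k]; only [c = 1] uses
    the full hypothesis on [r] and [s]. *)
Require Import Defs.
From mathcomp Require Import all_boot zify ring.
Set Implicit Arguments.
Unset Strict Implicit.
Unset Printing Implicit Defensive.

Lemma eqn_mod_pmul2l c x y p :
  coprime p c -> c * x = c * y %[mod p] -> x = y %[mod p].
Proof.
move=> co_pc; wlog le_yx : x y / y <= x => [IH|].
  by case/orP: (leq_total x y) => le_xy /esym; [move/IH/esym|move/esym/IH]; apply.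
move/eqP; rewrite eqn_mod_dvd ?leq_mul2l ?le_yx ?orbT // -mulnBr Gauss_dvdr //.
by rewrite -eqn_mod_dvd // => /eqP.
Qed.

Lemma eqn_modD p a b a' b' :
  a = a' %[mod p] -> b = b' %[mod p] -> a + b = a' + b' %[mod p].
Proof. by move=> e1 e2; rewrite -modnDm e1 e2 modnDm. Qed.

Lemma eqn_modM p a b a' b' :
  a = a' %[mod p] -> b = b' %[mod p] -> a * b = a' * b' %[mod p].
Proof. by move=> e1 e2; rewrite -modnMm e1 e2 modnMm. Qed.

Lemma eqn_modX p e a a' : a = a' %[mod p] -> a ^ e = a' ^ e %[mod p].
Proof. by move=> e1; rewrite -modnXm e1 modnXm. Qed.

Lemma eqn_mod_sum p n (F G : nat -> nat) :
  (forall k, k < n -> F k = G k %[mod p]) ->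
  \sum_(k < n) F k = \sum_(k < n) G k %[mod p].
Proof.
elim: n => [|n IH] FG; first by rewrite !big_ord0.
by rewrite !big_ord_recr /=; apply: eqn_modD; [apply: IH => k /ltnW/FG|apply: FG].
Qed.

Lemma big_ord_mul3 n (F : nat -> nat) :
  \sum_(k < 3 * n) F k =
  \sum_(k < n) (F (3 * k) + F (3 * k + 1) + F (3 * k + 2)).
Proof.
elim: n => [|n IH]; first by rewrite !big_ord0.
by rewrite mulnS add3n !big_ord_recr /= IH !addnA addn1 addn2.
Qed.

(** A pair, so that [rewrite] picks whichever case matches. *)
Lemma coprime9 a : (coprime 9 (3 * a + 1)) * (coprime 9 (3 * a + 2)).
Proof.
by split; rewrite (@coprime_pexpl 2 3) // prime_coprime // /dvdn; lia.
Qed.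

(** [(3k+1) C(3n, 3k+1) = (3n-3k) C(3n, 3k)], and [3k+1] is prime to 3. *)
Lemma dvd3_bin_0_1 n k : 3 %| 'C(3 * n, 3 * k + 1).
Proof.
rewrite -(@Gauss_dvdr 3 (3 * k + 1)); last by rewrite prime_coprime // /dvdn; lia.
by rewrite addn1 mul_bin_left -mulnBr -mulnA dvdn_mulr.
Qed.

Lemma dvd3_bin_0_2 n k : 3 %| 'C(3 * n, 3 * k + 2).
Proof.
rewrite -(@Gauss_dvdr 3 (3 * k + 2)); last by rewrite prime_coprime // /dvdn; lia.
by rewrite addn2 mul_bin_left dvdn_mull // -[X in 'C(_, X)]addn1 dvd3_bin_0_1.
Qed.

Lemma dvd3_bin_1_2 n k : 3 %| 'C(3 * n + 1, 3 * k + 2).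
Proof.
have := dvd3_bin_0_1 n k; have := dvd3_bin_0_2 n k.
by rewrite !addn1 addn2 binS; exact: dvdn_add.
Qed.

Lemma dvd3_exp_mod9 a e b c : 1 < e -> 3 %| a -> b * a ^ e * c = 0 %[mod 9].
Proof.
move=> e_gt1 a3; apply/eqP; rewrite mod0n -/(dvdn _ _) dvdn_mulr // dvdn_mull //.
by rewrite (dvdn_trans (dvdn_exp2l 3 e_gt1)) // dvdn_exp2r.
Qed.

(** Three uses of Pascal's rule give the outer terms plus three times a binomial that is itself a
    multiple of 3; the rest is Pascal's rule for [C(n+1, k+1)]. *)
Lemma bin_mul3_mod9 n k : 'C(3 * n, 3 * k) = 'C(n, k) %[mod 9].
Proof.
elim: n k => [|n IH] [|k]; rewrite ?muln0 ?bin0 ?bin0n //.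
have -> : 'C(3 * n.+1, 3 * k.+1)
   = 'C(3 * n, 3 * k.+1) + 'C(3 * n, 3 * k) + 3 * 'C(3 * n + 1, 3 * k + 2).
  rewrite !mulnS !add3n addn1 addn2 !binS; ring.
have /dvdnP[q ->] := dvd3_bin_1_2 n k.
have -> : 3 * (q * 3) = q * 9 by ring.
by rewrite addnC modnMDl binS; apply: eqn_modD; exact: IH.
Qed.

(** The ratio to [C(3(k+j), 3k)] is [(3(k+j)+1)/(3j+1)], which is [3k+1] modulo 9 because
    [(3j+1)(3k+1) = 9jk + 3(k+j)+1]. Writing the upper index as [k + j] avoids truncated
    subtraction. *)
Lemma bin_mul3_1_0_mod9 k j :
  'C(3 * (k + j) + 1, 3 * k) = (3 * k + 1) * 'C(k + j, k) %[mod 9].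
Proof.
apply: (@eqn_mod_pmul2l (3 * j + 1)); first by rewrite coprime9.
have -> : (3 * j + 1) * 'C(3 * (k + j) + 1, 3 * k)
          = (3 * (k + j) + 1) * 'C(3 * (k + j), 3 * k).
  have := mul_bin_down (3 * (k + j)).+1 (3 * k); rewrite /= !addn1 => ->.
  by congr (_ * _); lia.
have -> : (3 * j + 1) * ((3 * k + 1) * 'C(k + j, k))
          = 9 * (k * j * 'C(k + j, k)) + (3 * (k + j) + 1) * 'C(k + j, k) by ring.
by rewrite [9 * _]mulnC modnMDl; apply: eqn_modM => //; exact: bin_mul3_mod9.
Qed.

Lemma bin_mul3_1_1_mod9 k j :
  'C(3 * (k + j) + 1, 3 * k + 1) = (3 * j + 1) * 'C(k + j, k) %[mod 9].
Proof.
rewrite -bin_sub; last by lia.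
have -> : 3 * (k + j) + 1 - (3 * k + 1) = 3 * j by lia.
by rewrite [k + j]addnC bin_mul3_1_0_mod9 -[in RHS]bin_sub ?leq_addl // addnK.
Qed.

Lemma bin_mul3_2_0_mod9 k j :
  'C(3 * (k + j) + 2, 3 * k) = 'C(k + j, k) %[mod 9].
Proof.
apply: (@eqn_mod_pmul2l (3 * j + 2)); first by rewrite coprime9.
have -> : (3 * j + 2) * 'C(3 * (k + j) + 2, 3 * k)
          = (3 * (k + j) + 2) * 'C(3 * (k + j) + 1, 3 * k).
  have := mul_bin_down (3 * (k + j) + 2) (3 * k).
  have -> : (3 * (k + j) + 2).-1 = 3 * (k + j) + 1 by lia.
  by move=> ->; congr (_ * _); lia.
rewrite -modnMmr bin_mul3_1_0_mod9 modnMmr.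
(* Here the linear factors collapse: [(3(k+j)+2)(3k+1)] is [3j+2] modulo 9, so cancelling leaves no
   factor. *)
have -> : (3 * (k + j) + 2) * ((3 * k + 1) * 'C(k + j, k))
  = (k * (k + j + 1) * 'C(k + j, k)) * 9 + (3 * j + 2) * 'C(k + j, k) by ring.
by rewrite modnMDl.
Qed.

Lemma bin_mul3_2_1_mod9 k j :
  'C(3 * (k + j) + 2, 3 * k + 1) = (3 * (k + j) + 2) * 'C(k + j, k) %[mod 9].
Proof.
apply: (@eqn_mod_pmul2l (3 * k + 1)); first by rewrite coprime9.
have := mul_bin_diag (3 * (k + j) + 2) (3 * k).
have -> : (3 * (k + j) + 2).-1 = 3 * (k + j) + 1 by lia.
rewrite -[(3 * k).+1]addn1 => <-; rewrite -modnMmr bin_mul3_1_0_mod9 modnMmr.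
by rewrite mulnCA.
Qed.

Lemma exp3D1_mod9 a e b : (3 * a + 1) ^ (3 * e + b) = (3 * a + 1) ^ b %[mod 9].
Proof.
rewrite expnD expnM -modnMml -modnXm.
have -> : (3 * a + 1) ^ 3 = (3 * a ^ 3 + 3 * a ^ 2 + a) * 9 + 1 by ring.
by rewrite modnMDl modnXm exp1n modnMml mul1n.
Qed.

(** The cube of [3a+2] is 8 modulo 9 whatever [a] is; its powers still depend on the parity of
    [e]. *)
Lemma exp3D2_mod9 a e b :
  (3 * a + 2) ^ (3 * e + b) = 2 ^ (3 * e) * (3 * a + 2) ^ b %[mod 9].
Proof.
rewrite expnD !expnM -modnMml -modnXm.
have -> : (3 * a + 2) ^ 3 = (3 * a ^ 3 + 6 * a ^ 2 + 4 * a) * 9 + 2 ^ 3 by ring.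
by rewrite modnMDl modnXm modnMml.
Qed.

Definition apery_exponents r s : Prop :=
  [\/ r = 2 %[mod 3] /\ s = 2 %[mod 6],
      r = 0 %[mod 3] /\ s = 0 %[mod 3]
    | [/\ r = 1 %[mod 3], 4 <= r & s = 4 %[mod 6]]].

(** With [n = k + j], the summands on the left are the factors carried by the terms of index [3k]
    and [3k+1] in [apery r s (3n+1)]; the right side is [apery r s 1]. *)
Lemma apery_digit1_factor r s k j : apery_exponents r s ->
  (3 * k + 1) ^ r * (3 * k + 1) ^ s
    + (3 * j + 1) ^ r * (3 * (k + (k + j)) + 2) ^ s = 1 + 2 ^ s %[mod 9].
Proof.
move=> hrs.
have red b c : r = b %[mod 3] -> s = c %[mod 3] -> b < 3 -> c < 3 ->
    (3 * k + 1) ^ b * (3 * k + 1) ^ c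
      + (3 * j + 1) ^ b * (2 ^ (s - c) * (3 * (k + (k + j)) + 2) ^ c)
    = 1 + 2 ^ s %[mod 9] ->
  (3 * k + 1) ^ r * (3 * k + 1) ^ s
    + (3 * j + 1) ^ r * (3 * (k + (k + j)) + 2) ^ s = 1 + 2 ^ s %[mod 9].
  move=> rb sc b3 c3 <-.
  have -> : r = 3 * (r %/ 3) + b by lia.
  have {1 2}-> : s = 3 * (s %/ 3) + c by lia.
  have -> : s - c = 3 * (s %/ 3) by lia.
  by apply: eqn_modD; apply: eqn_modM; rewrite (exp3D1_mod9, exp3D2_mod9).
(* [2^6 = 64 = 7 * 9 + 1]: this is where [s] modulo 6 enters. *)
have pow64 e b : 2 ^ (6 * e + b) = 2 ^ b %[mod 9].
  by rewrite expnD expnM -modnMml -modnXm exp1n modnMml mul1n.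
case: hrs => [[r2 s2]|[r0 s0]|[r1 _ s4]].
- apply: (red 2 2) => //; first lia.
  have -> : s = 6 * (s %/ 6) + 2 by lia.
  rewrite -[in RHS]modnDmr pow64 modnDmr addnK -[6 * _]addn0 -modnDmr -modnMmr.
  rewrite -[X in _ * X %% _]modnMml pow64 modnMml modnMmr modnDmr.
  (* [(3j+1)(3(2k+j)+2) = 9q + 2(3k+1)], so [j] disappears modulo 9 and only powers of [3k+1]
     remain. *)
  set q := 2 * k * j + j ^ 2 + j.
  have -> : (3 * k + 1) ^ 2 * (3 * k + 1) ^ 2
            + (3 * j + 1) ^ 2 * (2 ^ 0 * (3 * (k + (k + j)) + 2) ^ 2)
     = (9 * k ^ 4 + 12 * k ^ 3 + 10 * k ^ 2 + 4 * k
        + q * (9 * q + 2 * (6 * k + 2))) * 9 + (1 + 2 ^ 2) by rewrite /q; ring.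
  by rewrite modnMDl.
- apply: (red 0 0) => //.
  by rewrite !expn0 muln1 mul1n subn0 muln1.
- apply: (red 1 1) => //; first lia.
  have -> : s = 6 * (s %/ 6) + 4 by lia.
  rewrite -[in RHS]modnDmr pow64 modnDmr -addnBA // -modnDmr -modnMmr.
  rewrite -[X in _ * X %% _]modnMml pow64 modnMml modnMmr modnDmr.
  set q := 2 * k * j + j ^ 2 + j.
  have -> : (3 * k + 1) ^ 1 * (3 * k + 1) ^ 1
            + (3 * j + 1) ^ 1 * (2 ^ (4 - 1) * (3 * (k + (k + j)) + 2) ^ 1)
     = (k ^ 2 + 8 * q + 6 * k) * 9 + (1 + 2 ^ 4) by rewrite /q; ring.
  by rewrite modnMDl.
Qed.

Lemma apery_mul3D_mod9 r s n c : apery_exponents r s -> 0 < r -> 0 < s -> c <= 2 ->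
  apery r s (3 * n + c) = apery r s c * apery r s n %[mod 9].
Proof.
move=> hrs r_gt0 s_gt0 c_le2.
(* An exponent of at least 2 turns divisibility by 3 into divisibility by 9; [4 <= r] excludes
   [r = 1]. *)
have [r_gt1 s_gt1] : 1 < r /\ 1 < s by case: hrs => [[? ?]|[? ?]|[? ? ?]]; lia.
pose t N k := 'C(N, k) ^ r * 'C(N + k, k) ^ s.
have -> : apery r s (3 * n + c) = \sum_(k < 3 * n.+1) t (3 * n + c) k.
  (* Pad the sum to full blocks of three: the added terms have [C(N, k) = 0] with a positive
     exponent. *)
  have le_cn : (3 * n + c).+1 <= 3 * n.+1 by lia.
  rewrite /apery (big_ord_widen _ (t (3 * n + c)) le_cn) big_mkcond /=.
  apply: eq_bigr => k _; case: ltnP => // lt_nk.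
  by rewrite /t bin_small // exp0n.
rewrite big_ord_mul3 [apery r s n]/apery big_distrr /=.
set N := 3 * n + c.
apply: (@eqn_mod_sum 9 n.+1 (fun k => t N (3 * k) + t N (3 * k + 1) + t N (3 * k + 2))
          (fun k => apery r s c * t n k)) => k; rewrite ltnS {}/N => le_kn.
have killr a b d : 3 %| a -> a ^ r * b ^ s = d * 0 %[mod 9].
  by move=> a3; rewrite -[a ^ r]mul1n muln0 dvd3_exp_mod9.
have kills a b d : 3 %| b -> a ^ r * b ^ s = d * 0 %[mod 9].
  by move=> b3; rewrite -[a ^ r * _]muln1 muln0 dvd3_exp_mod9.
have t0 : t (3 * n) (3 * k) = t n k %[mod 9].
  by rewrite /t -mulnDr; apply: eqn_modM; apply: eqn_modX; exact: bin_mul3_mod9.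
have sum_red x y z x' y' z' : x = x' %[mod 9] -> y = y' %[mod 9] ->
    z = z' %[mod 9] -> x + y + z = x' + y' + z' %[mod 9].
  by move=> ex ey ez; apply: eqn_modD ez; apply: eqn_modD.
have bin_nk : 'C(n + k, k) = 'C(k + n, k) by rewrite addnC.
case: c c_le2 => [|[|[|//]]] _.
- have -> : apery r s 0 * t n k = t n k + 1 * 0 + 1 * 0.
    by rewrite /apery big_ord1 !bin0 !exp1n !mul1n !addn0.
  rewrite addn0; apply: sum_red => //; apply: killr.
    exact: dvd3_bin_0_1.
  exact: dvd3_bin_0_2.
- pose j := n - k; have def_n : n = k + j by rewrite subnKC.
  have a1 : apery r s 1 = 1 + 2 ^ s.
    by rewrite /apery 2!big_ord_recl big_ord0 /= !bin0 !exp1n !mul1n addn0.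
  (* Split [1 + 2^s] into the two linear factors, one for each surviving index of the block. *)
  have -> : apery r s 1 * t n k %% 9 =
    ((3 * k + 1) ^ r * (3 * k + 1) ^ s * t n k
     + (3 * j + 1) ^ r * (3 * (k + n) + 2) ^ s * t n k + 1 * 0) %% 9.
    rewrite a1 -modnMml -(apery_digit1_factor k j hrs) modnMml -def_n.
    by rewrite addn0 mulnDl.
  apply: sum_red.
  + rewrite /t mulnACA -!expnMn; apply: eqn_modM; apply: eqn_modX.
      by rewrite def_n bin_mul3_1_0_mod9.
    (* The second binomial is treated like the first, with [n] in the role of [j]. *)
    by rewrite bin_nk -bin_mul3_1_0_mod9; congr ('C(_, _) %% _); lia.
  + rewrite /t mulnACA -!expnMn; apply: eqn_modM; apply: eqn_modX.
      by rewrite def_n bin_mul3_1_1_mod9.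
    by rewrite bin_nk -bin_mul3_2_1_mod9; congr ('C(_, _) %% _); lia.
  + by apply: killr; exact: dvd3_bin_1_2.
- pose j := n - k; have def_n : n = k + j by rewrite subnKC.
  (* [apery r s 2 = 1 + 2^r 3^s + 6^s], and [s >= 2]. *)
  have a2 : apery r s 2 = 1 %[mod 9].
    rewrite /apery 3!big_ord_recl big_ord0 /= !bin0 !exp1n !mul1n addn0.
    rewrite -[RHS]/((1 + (1 * 0 + 1 * 0)) %% 9).
    apply: eqn_modD => //; apply: eqn_modD; first exact: kills.
    by rewrite -[_ ^ s]mul1n -{1}(exp1n r); exact: kills.
  have -> : apery r s 2 * t n k %% 9 = (t n k + 1 * 0 + 1 * 0) %% 9.
    by rewrite -modnMml a2 modnMml mul1n !addn0.
  apply: sum_red.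
  + rewrite /t; apply: eqn_modM; apply: eqn_modX.
      by rewrite def_n bin_mul3_2_0_mod9.
    by rewrite bin_nk -bin_mul3_2_0_mod9; congr ('C(_, _) %% _); lia.
  + apply: kills.
    (* Adding the last digits 2 and 1 carries, so 3 divides the second binomial. *)
    have -> : 3 * n + 2 + (3 * k + 1) = 3 * (n + k).+1 by lia.
    exact: dvd3_bin_0_1.
  + apply: kills.
    have -> : 3 * n + 2 + (3 * k + 2) = 3 * (n + k).+1 + 1 by lia.
    exact: dvd3_bin_1_2.
Qed.

Theorem mainTheorem6 (r s : nat) (r_gt0 : 0 < r) (s_gt0 : 0 < s)
    (hrs : [\/ r = 2 %[mod 3] /\ s = 2 %[mod 6],
               r = 0 %[mod 3] /\ s = 0 %[mod 3]
             | [/\ r = 1 %[mod 3], 4 <= r & s = 4 %[mod 6]]])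
    (n m : nat) (d : 'I_m.+1 -> nat)
    (d_digit : forall i, d i <= 2)
    (n_digits : n = \sum_(i < m.+1) 3 ^ i * d i) :
  apery r s n = \prod_(i < m.+1) apery r s (d i) %[mod 9].
Proof.
elim: m n d d_digit n_digits => [|m IH] n d d_digit ->.
  by rewrite !big_ord1 mul1n.
(* Peel off the lowest digit, in Horner form; the shifted digits feed the induction hypothesis. *)
have -> : \sum_(i < m.+2) 3 ^ i * d i
    = 3 * (\sum_(i < m.+1) 3 ^ i * d (lift ord0 i)) + d ord0.
  rewrite big_ord_recl mul1n addnC big_distrr; congr (_ + _).
  by apply: eq_bigr => i _; rewrite /= mulnA -expnS.
rewrite apery_mul3D_mod9 // [in RHS]big_ord_recl; apply: eqn_modM => //.
exact: IH.
Qed.
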